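(* For each $n$, let $Y=(Y(t):t\ge0)$ be a continuous-time birth-death chain on $\{0,1,\dots,n\}$ with birth and death rates in state $y$ given by $q_+(y)=nf_n(y/n)$ and $q_-(y)=ng_n(y/n)$, respectively, where $f_n,g_n:[0,1]\to[0,\infty)$ are continuous functions with $f_n(z),g_n(z)>0$ for all $z\in(0,1)$, satisfying, for some $0<r_1<r_2<1$ (not depending on $n$), $$f_n(z)-g_n(z)<0\quad\text{for all } z\in(r_1,r_2).$$ Assume there exist constants $c>1$ and $n_0\ge1$ such that for all $n\ge n_0$ and all $y\in\{0,1,\dots,n\}$, $$0<q_-(y)+q_+(y)\le\frac1c\,n .$$ Assume also that $h_n=g_n/f_n$ satisfies $\inf_{n,\,z\in[r_1+\epsilon,r_2-\epsilon]}h_n(z)>1$ for any $\epsilon>0$, and has uniformly bounded derivative on $[r_1,r_2]$, i.e. $\sup_{n,\,z\in[r_1,r_2]}|h_n'(z)|<\infty$. Define $T_r=\inf\{t\ge0:Y(t)=\lceil nr\rceil\text{ or }Y(t)=\lfloor nr\rfloor\}$. Then for each $p\in(r_1,r_2)$ there exist positive constants $\kappa_1,\kappa_2$ such that for all $n\ge 2\vee n_0$, $$\mathbb{P}_{\lceil np\rceil}\left(T_{r_2}\ge\exp(\kappa_1n)\right)\ge1-\kappa_2n^2\exp(-2n\kappa_1),$$ where $\mathbb{P}_y$ denotes probability conditioned on $Y(0)=y$.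
   Context: A birth-death chain on $\{0,\dots,n\}$ jumps from $y$ to $y+1$ at rate $q_+(y)$ and from $y$ to $y-1$ at rate $q_-(y)$ (in particular $q_-(0)=0=q_+(n)$). $a\vee b=\max(a,b)$. *)

(* Defs.v *)
From HB Require Import structures.
From mathcomp Require Import all_boot all_order all_algebra.
From mathcomp Require Import all_classical all_reals all_analysis.

Set Implicit Arguments.
Unset Strict Implicit.
Unset Printing Implicit Defensive.

Import Order.TTheory GRing.Theory Num.Theory.
Import numFieldNormedType.Exports.

Local Open Scope classical_set_scope.
Local Open Scope ring_scope.

Definition bd_generator (R : realType) (n : nat) (qp qm : 'I_n.+1 -> R) :
    'M[R]_n.+1 :=
  \matrix_(i, j) (if j == i.+1 :> nat then qp i
                  else if i == j.+1 :> nat then qm i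
                  else if i == j then - (qp i + qm i)
                  else 0).

(* Only the times t >= 0 matter. On a finite state space, the conditions below
   determine Pt t = exp (t Q) for t >= 0. *)
Definition is_transition_function (R : realType) (m : nat) (Q : 'M[R]_m)
    (Pt : R -> 'M[R]_m) : Prop :=
  [/\ forall t i j, 0 <= t -> 0 <= Pt t i j,
      forall t i, 0 <= t -> \sum_j Pt t i j = 1,
      Pt 0 = 1%:M,
      forall s t, 0 <= s -> 0 <= t -> Pt (s + t) = Pt s *m Pt t &
      forall i j, (Pt t i j - (1%:M : 'M[R]_m) i j) / t @[t --> 0^'+] --> Q i j].

(* A time-homogeneous Markov process on {0, ..., n} with right-continuous paths
   and an arbitrary initial law. In the Markov property the past is given by
   the values at finitely many times t_0 <= ... <= t_k, and conditional
   probabilities are multiplied out so as to allow null conditioning events. *)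
Definition is_birth_death_chain (R : realType) (d : measure_display)
    (Omega : measurableType d) (P : probability Omega R) (n : nat)
    (qp qm : 'I_n.+1 -> R) (Y : R -> Omega -> 'I_n.+1) : Prop :=
  [/\ qm ord0 = 0 /\ qp ord_max = 0,
      forall t i, 0 <= t -> measurable [set w | Y t w = i],
      forall w t, 0 <= t -> \forall s \near t^'+, Y s w = Y t w &
      exists Pt : R -> 'M[R]_n.+1,
        is_transition_function (bd_generator qp qm) Pt /\
        forall (k : nat) (t : nat -> R) (i : nat -> 'I_n.+1),
          0 <= t 0%N ->
          (forall j, (j <= k)%N -> t j <= t j.+1) ->
          (P [set w | forall j, (j <= k.+1)%N -> Y (t j) w = i j] =
           P [set w | forall j, (j <= k)%N -> Y (t j) w = i j] *
           (Pt (t k.+1 - t k) (i k) (i k.+1))%:E)%E].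

(* The infimum of the empty set is +oo. *)
Definition hitting_time (R : realType) (Omega : Type) (n : nat)
    (Y : R -> Omega -> 'I_n.+1) (r : R) (w : Omega) : \bar R :=
  ereal_inf [set t%:E | t in [set t : R | 0 <= t /\
    ((Y t w : nat)%:Z = Num.ceil (n%:R * r) \/
     (Y t w : nat)%:Z = Num.floor (n%:R * r))]].

Definition cond_prob (R : realType) (d : measure_display)
    (Omega : measurableType d) (P : probability Omega R) (A B : set Omega) : R :=
  fine (P (A `&` B)) / fine (P B).

Definition scaled_rate (R : realType) (n : nat) (f : R -> R) (y : 'I_n.+1) : R :=
  n%:R * f (y%:R / n%:R).

(* Main.v *)
Require Import Defs.
From HB Require Import structures.
From mathcomp Require Import all_boot all_order all_algebra.
From mathcomp Require Import all_classical all_reals all_analysis.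
From mathcomp Require Import ring lra zify.
Import Order.TTheory GRing.Theory Num.Theory.
Import numFieldNormedType.Exports.
Local Open Scope classical_set_scope.
Local Open Scope ring_scope.

(** Let rho > 1 be a uniform lower bound for h_n on [r1 + eps, r2 - eps], and put
    a = ceil(n p), b = floor(n (r2 - eps)). The function V(y) = rho^(clip(y) - b),
    where clip projects onto [a, b], equals 1 at the target states and
    rho^(a - b) at the starting state. Since q_- >= rho q_+ strictly between a and
    b, QV, with Q the generator, is positive at most at y = a, where it is less than
    E = rho^(a - b) (rho - 1) n. Hence, along any sufficiently fine time grid,
    V(Y(t)) - E t is a supermartingale, and a maximal inequality bounds the
    probability of meeting the target on the grid before time tau by
    rho^(a - b) + tau E. Right-continuity of the paths transfers this bound from
    dyadic grids to continuous time, and tau = exp(kappa1 n) with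
    kappa1 = (r2 - eps - p) ln(rho) / 3 gives the claim. *)

(** * The generator and short-time transition probabilities *)

Lemma sum_ord_delta (R : realType) (n k : nat) (x : R) (V : nat -> R) :
  \sum_(j < n) (if j == k :> nat then x * V j else 0) =
  if (k < n)%N then x * V k else 0.
Proof.
case: ltnP => kn; last first.
  by apply: big1 => j _; case: eqP => // jk; have := ltn_ord j; lia.
rewrite (bigD1 (Ordinal kn)) //= eqxx big1 ?addr0 // => j.
by rewrite -val_eqE /= => /negPf ->.
Qed.

(** Taking [V] on all of [nat] gives one formula without boundary cases: at state [0] the truncated
    predecessor is the state itself, and at state [n] the value [V n.+1], outside the state space,
    is multiplied by a zero birth rate. *)
Lemma bd_generator_mul (R : realType) (n : nat) (qp qm : 'I_n.+1 -> R)
    (V : nat -> R) (i : 'I_n.+1) : qm ord0 = 0 -> qp ord_max = 0 ->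
  \sum_j bd_generator qp qm i j * V j =
  qp i * (V i.+1 - V i) + qm i * (V i.-1 - V i).
Proof.
move=> qm0 qpn.
transitivity (\sum_(j < n.+1) (if j == i.+1 :> nat then qp i * V j else 0) +
  \sum_(j < n.+1) (if j == i.-1 :> nat then qm i * V j else 0) +
  \sum_(j < n.+1) (if j == i :> nat then - (qp i + qm i) * V j else 0)).
  rewrite -!big_split /=; apply: eq_bigr => j _; rewrite mxE -val_eqE /=.
  rewrite (eq_sym (i : nat) j).
  case: (unliftP ord0 i) => [i'|] ->; last first.
    by rewrite qm0; do ?case: ifPn => ?; rewrite ?mul0r ?addr0 ?add0r //; exfalso; lia.
  rewrite /= /bump /=.
  by do ?case: ifPn => ?; rewrite ?mul0r ?addr0 ?add0r //; exfalso; lia.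
rewrite !sum_ord_delta ltn_ord (leq_ltn_trans (leq_pred i)) // ltnS.
case: ltnP => [_|ni]; first by ring.
have -> : i = ord_max by apply: val_inj => /=; have := ltn_ord i; lia.
by rewrite qpn; ring.
Qed.

(* The strict bound on [Q V] absorbs the o(s) error, so that the differential
   inequality is not needed beyond small times. *)
Lemma transition_short_time (R : realType) (m : nat) (Q : 'M[R]_m)
    (Pt : R -> 'M[R]_m) (V : 'I_m -> R) (e : R) :
  is_transition_function Q Pt -> (forall i, \sum_j Q i j * V j < e) ->
  \forall s \near 0^'+, forall i, \sum_j Pt s i j * V j <= V i + s * e.
Proof.
move=> [_ _ _ _ Qlim] QV; apply: filter_forall => i.
have cv : \sum_j (Pt s i j - (1%:M : 'M[R]_m) i j) / s * V j @[s --> 0^'+] -->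
          \sum_j Q i j * V j.
  by apply: cvg_big => [|j _]; [exact: add_continuous|apply: cvgMr_tmp; exact: Qlim].
near=> s.
have s0 : 0 < s by near: s; exact: nbhs_right_gt.
have : \sum_j (Pt s i j - (1%:M : 'M[R]_m) i j) / s * V j < e.
  by near: s; exact: (cvgr_lt _ cv).
have -> : \sum_j (Pt s i j - (1%:M : 'M[R]_m) i j) / s * V j =
          (\sum_j Pt s i j * V j - V i) / s.
  under eq_bigr do rewrite mulrAC mulrBl.
  rewrite -mulr_suml sumrB; congr ((_ - _) / _).
  rewrite (bigD1 i) //= mxE eqxx mul1r big1 ?addr0 // => j ji.
  by rewrite mxE eq_sym (negPf ji) mul0r.
by rewrite ltr_pdivrMr // => /ltW; lra.
Unshelve. all: by end_near. Qed.

(** * A maximal inequality along a time grid *)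

Definition grid_cylinder {R : realType} {T : Type} {n : nat} (Y : R -> T -> 'I_n.+1)
    (s : R) (k : nat) (i : nat -> 'I_n.+1) : set T :=
  [set w | forall j, (j <= k)%N -> Y (j%:R * s) w = i j].

(** The window starts at a variable index [k], so that an induction can advance it along the
    grid. *)
Definition grid_hit {R : realType} {T : Type} {n : nat} (Y : R -> T -> 'I_n.+1)
    (s : R) (tgt : pred 'I_n.+1) (k m : nat) : set T :=
  [set w | exists2 j, (k <= j <= k + m)%N & tgt (Y (j%:R * s) w)].

(** The strict bound on [t] makes the complement exactly the event that the hitting time is at least
    [tau]. *)
Definition hit_before {R : realType} {T : Type} {n : nat} (Y : R -> T -> 'I_n.+1)
    (tgt : pred 'I_n.+1) (tau : R) : set T :=
  [set w | exists2 t, 0 <= t < tau & tgt (Y t w)].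

Section Maximal.
Context (R : realType) (d : measure_display) (Omega : measurableType d)
  (P : probability Omega R) (n : nat).
Variables (Y : R -> Omega -> 'I_n.+1) (K : 'M[R]_n.+1) (s : R) (tgt : pred 'I_n.+1)
  (V : 'I_n.+1 -> R) (e : R).

Hypothesis s_ge0 : 0 <= s.
Hypothesis Ym : forall t i, 0 <= t -> measurable [set w | Y t w = i].

Lemma measurable_grid_cylinder k i : measurable (grid_cylinder Y s k i).
Proof.
have -> : grid_cylinder Y s k i = \bigcap_(j in [set j | (j <= k)%N]) [set w | Y (j%:R * s) w = i j].
  by apply/seteqP; split => w; apply.
apply: bigcap_measurable; first by exists 0%N.
by move=> j _; apply: Ym; rewrite mulr_ge0.
Qed.

Lemma measurable_preim t (Q : pred 'I_n.+1) : 0 <= t -> measurable [set w | Q (Y t w)].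
Proof.
move=> t0.
have -> : [set w | Q (Y t w)] = \bigcup_(i in [set i | Q i]) [set w | Y t w = i].
  by apply/seteqP; split => w /=; [move=> h; exists (Y t w)|case=> i /= Qi ->].
by apply: fin_bigcup_measurable => // i _; exact: Ym.
Qed.

Lemma measurable_grid_hit k m : measurable (grid_hit Y s tgt k m).
Proof.
have -> : grid_hit Y s tgt k m = \bigcup_(j in [set j | (k <= j <= k + m)%N]) [set w | tgt (Y (j%:R * s) w)].
  by apply/seteqP; split => w /= [j ? ?]; exists j.
by apply: bigcup_measurable => j _; apply: measurable_preim; rewrite mulr_ge0.
Qed.

Hypothesis markov : forall k i,
  P (grid_cylinder Y s k.+1 i) = (P (grid_cylinder Y s k i) * (K (i k) (i k.+1))%:E)%E.
Hypothesis K_sum : forall i, \sum_j K i j = 1.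
Hypothesis KV : forall i, \sum_j K i j * V j <= V i + s * e.
Hypothesis e_ge0 : 0 <= e.
Hypothesis V_ge0 : forall i, 0 <= V i.
Hypothesis V_tgt : forall i, tgt i -> 1 <= V i.

(** With [m] steps left, the value [V + m * s * e] dominates 1 on the target and does not increase
    in mean at a step, since the drift of at most [s * e] is paid for by the loss of one step.
    Multiplying by the probability of the cylinder covers null pasts. *)
Lemma grid_hit_le m : forall k i,
  (P (grid_cylinder Y s k i `&` grid_hit Y s tgt k m) <=
   P (grid_cylinder Y s k i) * (V (i k) + m%:R * s * e)%:E)%E.
Proof.
have base m' k i : tgt (i k) -> (P (grid_cylinder Y s k i `&` grid_hit Y s tgt k m') <=
   P (grid_cylinder Y s k i) * (V (i k) + m'%:R * s * e)%:E)%E.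
  move=> ti; have mC := measurable_grid_cylinder k i.
  apply: (@le_trans _ _ (P (grid_cylinder Y s k i))).
    apply: le_measure; rewrite ?inE//.
    by apply: measurableI => //; exact: measurable_grid_hit.
  rewrite -[leLHS]mule1 lee_wpmul2l ?fin_num_measure ?lee_fin //.
  by rewrite (le_trans (V_tgt _ ti))// lerDl !mulr_ge0.
(* Backward induction: condition on the state at the next grid point. *)
elim: m => [|m IH] k i.
  have [ti|/negP nti] := boolP (tgt (i k)); first exact: base.
  rewrite (_ : _ `&` _ = set0) ?measure0 ?mule_ge0 ?lee_fin ?mul0r ?addr0 //.
  rewrite -subset0 => w /= [Cw [j]]; rewrite addn0 -eqn_leq => /eqP <-.
  by rewrite Cw.
have [ti|/negP nti] := boolP (tgt (i k)); first exact: base.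
(* [upd x] prolongs the prescribed past by the state [x] at time [k.+1]. Since the state at time [k]
   is not in the target, a hit must occur in the window starting at [k.+1]. *)
pose upd x j := if j == k.+1 then x else i j.
have CS x : grid_cylinder Y s k (upd x) = grid_cylinder Y s k i.
  apply/seteqP; split => w /= Cw j jk; have := Cw j jk; rewrite /upd ltn_eqF //.
have ukS x : upd x k.+1 = x by rewrite /upd eqxx.
have uk x : upd x k = i k by rewrite /upd ltn_eqF.
have mC := measurable_grid_cylinder k i.
have := content_sub_fsum P (D := [set: 'I_n.+1])
  (A := grid_cylinder Y s k i `&` grid_hit Y s tgt k m.+1)
  (A_ := fun x => grid_cylinder Y s k.+1 (upd x) `&` grid_hit Y s tgt k.+1 m).
move=> /(_ finite_finset)/(_ _ _ _)/le_trans; apply.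
- by move=> x _; apply: measurableI; [exact: measurable_grid_cylinder|exact: measurable_grid_hit].
- by apply: measurableI => //; exact: measurable_grid_hit.
- move=> w [/= Cw [j /andP[kj jm] tj]]; exists (Y (k.+1%:R * s) w) => //; split => /=.
    move=> l; rewrite leq_eqVlt ltnS => /predU1P[->|lk]; first by rewrite ukS.
    by rewrite /upd ltn_eqF ?ltnS//; exact: Cw.
  exists j => //; rewrite addSnnS jm andbT ltn_neqAle kj andbT.
  by apply/eqP => kj'; move: tj; rewrite -kj' Cw.
have -> : [set: 'I_n.+1] = [set` enum 'I_n.+1].
  by apply/seteqP; split => // x _ /=; rewrite mem_enum.
rewrite -fsbig_seq ?enum_uniq// big_enum /=.
have Pc : P (grid_cylinder Y s k i) = (fine (P (grid_cylinder Y s k i)))%:E.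
  by rewrite fineK// fin_num_measure.
have c0 : 0 <= fine (P (grid_cylinder Y s k i)) by rewrite fine_ge0.
apply: (@le_trans _ _ (\sum_x (fine (P (grid_cylinder Y s k i)) * (K (i k) x * (V x + m%:R * s * e)))%:E)%E).
  apply: lee_sum => x _; apply: le_trans (IH _ _) _.
  by rewrite markov CS ukS uk Pc -!EFinM mulrA.
rewrite sumEFin Pc -EFinM lee_fin -mulr_sumr ler_wpM2l //.
under eq_bigr do rewrite mulrDr.
rewrite big_split /= -mulr_suml K_sum mul1r.
by have := KV (i k); rewrite -natr1; lra.
Qed.
End Maximal.

(** * From dyadic grids to continuous time *)

Lemma near_dyadic_lt (R : realType) (x e : R) : 0 < e ->
  \forall k \near \oo, x / 2 ^+ k < e.
Proof.
move=> e0; near=> k; rewrite ltr_pdivrMr ?exprn_gt0// mulrC -ltr_pdivrMr//.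
apply: (@lt_le_trans _ _ k%:R); first by near: k; exact: nbhs_infty_gtr.
by rewrite -natrX ler_nat ltnW// ltn_expl.
Unshelve. all: by end_near. Qed.

(** A right-continuous path in a discrete space stays in its state for a short while after [t], so a
    fine enough grid also sees the hit. The last index [(2 ^ k).-1] keeps grid times strictly below
    [tau]. *)
Lemma hit_before_dyadic (R : realType) (T : Type) (n : nat)
    (Y : R -> T -> 'I_n.+1) (tgt : pred 'I_n.+1) (tau : R) :
  0 < tau -> (forall w t, 0 <= t -> \forall s \near t^'+, Y s w = Y t w) ->
  hit_before Y tgt tau =
  \bigcup_k grid_hit Y (tau / 2 ^+ k) tgt 0 (2 ^ k).-1.
Proof.
move=> tau0 Yr; apply/seteqP; split => w /=; last first.
  case=> k _ [j /andP[_ jk] tj]; exists (j%:R * (tau / 2 ^+ k)) => //.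
  have {}jk : (j < 2 ^ k)%N by have := expn_gt0 2 k; lia.
  rewrite mulr_ge0 ?divr_ge0 ?exprn_ge0 ?(ltW tau0)//= mulrCA gtr_pMr//.
  by rewrite ltr_pdivrMr ?exprn_gt0// mul1r -natrX ltr_nat.
case=> t /andP[t0 tt] ti.
have [e /= e0 He] := Yr w t t0.
have : \forall k \near \oo, tau / 2 ^+ k < Num.min e (tau - t).
  by apply: near_dyadic_lt; rewrite lt_min e0 subr_gt0.
case=> k _ /(_ k (leqnn k)) /=; rewrite lt_min => /andP[ke kt].
have s0 : 0 < tau / 2 ^+ k by rewrite divr_gt0 ?exprn_gt0.
set s := tau / 2 ^+ k in ke kt s0 *.
have ts0 : 0 <= t / s by rewrite divr_ge0 // ltW.
have /andP[lo hi] := truncn_itv ts0.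
move: lo hi; rewrite ler_pdivlMr// ltr_pdivrMr//.
(* The grid time with index [j.+1] is the first one strictly after [t]; it exceeds [t] by at most
   [s], hence by less than both [e] and [tau - t]. *)
set j := Num.truncn _ => lo hi.
have hs : j.+1%:R * s <= t + s by rewrite -natr1 mulrDl mul1r lerD2r.
exists k => //; exists j.+1.
  have : j.+1%:R * s < tau by lra.
  rewrite /s mulrCA gtr_pMr// ltr_pdivrMr ?exprn_gt0// mul1r -natrX ltr_nat.
  by lia.
rewrite (He (j.+1%:R * s)) //=.
by rewrite distrC ger0_norm; lra.
Qed.

(** Doubling the index embeds each grid in the next one. This monotonicity is what permits
    continuity of the measure from below. *)
Lemma grid_hit_dyadic_nondecreasing (R : realType) (T : Type) (n : nat)
    (Y : R -> T -> 'I_n.+1) (tgt : pred 'I_n.+1) (tau : R) :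
  nondecreasing_seq (fun k => grid_hit Y (tau / 2 ^+ k) tgt 0 (2 ^ k).-1).
Proof.
apply/nondecreasing_seqP => k; rewrite subsetEset => w [j jk tj].
exists (j.*2).
  by rewrite expnS; have := expn_gt0 2 k; lia.
move: tj; congr (is_true (tgt (Y _ w))).
by rewrite -muln2 natrM exprS; field; rewrite expf_neq0.
Qed.

(** The grid bounds hold for all fine meshes with a right-hand side independent of the mesh, so they
    pass to the limit along the increasing dyadic events. *)
Lemma chain_hit_before (R : realType) (d : measure_display)
    (Omega : measurableType d) (P : probability Omega R) (n : nat)
    (qp qm : 'I_n.+1 -> R) (Y : R -> Omega -> 'I_n.+1) (tgt : pred 'I_n.+1)
    (V : 'I_n.+1 -> R) (e tau : R) (a : 'I_n.+1) :
  is_birth_death_chain P qp qm Y ->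
  0 < tau -> 0 <= e -> (forall i, 0 <= V i) -> (forall i, tgt i -> 1 <= V i) ->
  (forall i, \sum_j bd_generator qp qm i j * V j < e) ->
  measurable (hit_before Y tgt tau) /\
  (P ([set w | Y 0%R w = a] `&` hit_before Y tgt tau) <=
   P [set w | Y 0%R w = a] * (V a + tau * e)%:E)%E.
Proof.
move=> [_ Ym Yr [Pt [PtQ Ymk]]] tau0 e0 V0 Vt QV.
set D := fun k => grid_hit Y (tau / 2 ^+ k) tgt 0 (2 ^ k).-1.
have s0 k : 0 < tau / 2 ^+ k by rewrite divr_gt0 ?exprn_gt0.
have mD k : measurable (D k).
  by apply: measurable_grid_hit => //; exact: ltW (s0 k).
rewrite hit_before_dyadic//; split; first by apply: bigcup_measurable => k _; exact: mD.
rewrite setI_bigcupr.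
set A := [set w | Y 0 w = a]; have mA : measurable A by exact: Ym.
have mAD k : measurable (A `&` D k) by exact: measurableI.
have cvgAD : P \o (fun k => A `&` D k) @ \oo --> P (\bigcup_k (A `&` D k)).
  apply: nondecreasing_cvg_mu => //; first exact: bigcup_measurable.
  move=> k l kl; rewrite subsetEset; apply: setIS.
  by rewrite -subsetEset; exact: grid_hit_dyadic_nondecreasing.
rewrite -(cvg_lim _ cvgAD)//; apply: lime_le; first exact: cvgP cvgAD.
have [d0 /= d00 Hd] := transition_short_time _ _ _ _ _ _ PtQ QV.
near=> k => /=.
have kd : tau / 2 ^+ k < d0 by near: k; exact: near_dyadic_lt.
have := grid_hit_le _ _ _ P _ Y (Pt (tau / 2 ^+ k)) (tau / 2 ^+ k) tgt V e.
move=> /(_ (ltW (s0 k)) Ym _ _ _ e0 V0 Vt (2 ^ k).-1 0%N (fun=> a)).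
have -> : grid_cylinder Y (tau / 2 ^+ k) 0 (fun=> a) = A.
  apply/seteqP; split => w /=; first by move=> /(_ 0%N isT); rewrite mul0r.
  by move=> Aw j; rewrite leqn0 => /eqP->; rewrite mul0r.
move=> H; apply: le_trans (H _ _ _) _.
- move=> l i; rewrite /grid_cylinder (Ymk l (fun j => j%:R * (tau / 2 ^+ k))).
  + by rewrite -mulrBl -natrB// subSnn mul1r.
  + by rewrite mul0r.
  + by move=> j _; rewrite ler_wpM2r ?ler_nat// ltW.
- by move=> i; case: PtQ => _ + _ _ _; apply; exact: ltW.
- by apply: Hd => //=; rewrite distrC subr0 gtr0_norm.
(* The [(2 ^ k).-1] steps of length [tau / 2 ^+ k] last at most [tau] in total. *)
- rewrite lee_wpmul2l// lee_fin lerD2l ler_wpM2r// mulrCA ger_pMr//.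
  rewrite ler_pdivrMr ?exprn_gt0// mul1r -natrX ler_nat; lia.
Unshelve. all: by end_near. Qed.

(** * Drift of the truncated exponential *)

(* This is [rho ^ (clip y - b)], written as a quotient to avoid negative powers. *)
Definition clip_pow {R : realType} (rho : R) (a b y : nat) : R :=
  rho ^+ (minn (maxn y a) b) / rho ^+ b.

Lemma clip_pow_left (R : realType) (rho : R) (a b : nat) :
  (a <= b)%N -> clip_pow rho a b a = rho ^+ a / rho ^+ b.
Proof. by move=> ab; rewrite /clip_pow maxnn (minn_idPl ab). Qed.

Lemma clip_pow_right (R : realType) (rho : R) (a b y : nat) :
  0 < rho -> (b <= y)%N -> clip_pow rho a b y = 1.
Proof.
move=> rho0 yb; rewrite /clip_pow (_ : minn _ _ = b); last by lia.
by rewrite divff// expf_neq0 ?gt_eqF.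
Qed.

(** Outside [[a, b]] the function is locally constant; strictly inside, deaths outweigh births; at
    [b] only a death changes it, downwards. Only a birth at [a] contributes positively, and [qp < N]
    there gives the strict bound. *)
Lemma clip_pow_drift (R : realType) (n : nat) (qp qm : 'I_n.+1 -> R)
    (rho N : R) (a b : nat) :
  qm ord0 = 0 -> qp ord_max = 0 -> 1 < rho -> 0 < N -> (a < b)%N ->
  (forall i, 0 <= qp i) -> (forall i, 0 <= qm i) ->
  (forall i : 'I_n.+1, i = a :> nat -> qp i < N) ->
  (forall i : 'I_n.+1, (a < i < b)%N -> rho * qp i <= qm i) ->
  forall i : 'I_n.+1, \sum_j bd_generator qp qm i j * clip_pow rho a b j <
    rho ^+ a / rho ^+ b * ((rho - 1) * N).
Proof.
move=> qm0 qpn rho1 N0 ab qp0 qm_ge0 qpa qpm i.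
rewrite bd_generator_mul// /clip_pow.
have rb k : 0 < rho ^+ k / rho ^+ b by rewrite divr_gt0// exprn_gt0; lra.
have E0 : 0 < rho ^+ a / rho ^+ b * ((rho - 1) * N).
  by rewrite mulr_gt0// mulr_gt0// subr_gt0.
have qpi := qp0 i; have qmi := qm_ge0 i.
have [[ia|ia]|ia] : (((i < a) \/ (a < i)) \/ i = a :> nat)%N by lia.
- have -> : minn (maxn i.+1 a) b = a by lia.
  have -> : minn (maxn i.-1 a) b = a by lia.
  have -> : minn (maxn i a) b = a by lia.
  by rewrite !subrr !mulr0 addr0.
- have [[ib|ib]|ib] : (((i < b) \/ (b < i)) \/ i = b :> nat)%N by lia.
  (* All three values are expressed through the power [i.-1], legitimate because [i > a] forces
     [i > 0]. *)
  + have -> : minn (maxn i.+1 a) b = i.-1.+2 by lia.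
    have -> : minn (maxn i.-1 a) b = i.-1 by lia.
    have -> : minn (maxn i a) b = i.-1.+1 by lia.
    have := rb i.-1; rewrite !exprS; set x := rho ^+ _ / _ => x0.
    apply: le_lt_trans E0.
    have -> : qp i * (rho * (rho * rho ^+ i.-1) / rho ^+ b -
                rho * rho ^+ i.-1 / rho ^+ b) +
              qm i * (rho ^+ i.-1 / rho ^+ b - rho * rho ^+ i.-1 / rho ^+ b) =
              - (x * (rho - 1) * (qm i - rho * qp i)) by rewrite /x; ring.
    rewrite oppr_le0; apply: mulr_ge0; first by apply: mulr_ge0; lra.
    by rewrite subr_ge0 qpm// ia ib.
  + have -> : minn (maxn i.+1 a) b = b by lia.
    have -> : minn (maxn i.-1 a) b = b by lia.
    have -> : minn (maxn i a) b = b by lia.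
    by rewrite !subrr !mulr0 addr0.
  + have -> : minn (maxn i.+1 a) b = i by lia.
    have -> : minn (maxn i.-1 a) b = i.-1 by lia.
    have -> : minn (maxn i a) b = i by lia.
    apply: le_lt_trans E0; rewrite subrr mulr0 add0r mulr_ge0_le0// subr_le0.
    rewrite ler_pM2r ?invr_gt0 ?exprn_gt0//; last lra.
    by apply: ler_weXn2l; [exact: ltW|exact: leq_pred].
- have -> : minn (maxn i.+1 a) b = a.+1 by lia.
  have -> : minn (maxn i.-1 a) b = a by lia.
  have -> : minn (maxn i a) b = a by lia.
  rewrite subrr mulr0 addr0 exprS.
  have := rb a; set x := _ / _ => x0.
  have -> : qp i * (rho * rho ^+ a / rho ^+ b - x) = x * ((rho - 1) * qp i).
    by rewrite /x; ring.
  by rewrite ltr_pM2l// ltr_pM2l ?subr_gt0//; exact: qpa.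
Qed.

(** * Conditional probabilities and exponential estimates *)

Lemma cond_prob_setC_ge (R : realType) (d : measure_display)
    (Omega : measurableType d) (P : probability Omega R) (H B : set Omega) (x : R) :
  measurable H -> measurable B -> (0 < P B)%E ->
  (P (B `&` H) <= P B * x%:E)%E -> 1 - x <= cond_prob P (~` H) B.
Proof.
move=> mH mB PB BH; rewrite /cond_prob.
have fB : P B \is a fin_num by exact: fin_num_measure.
have fBH : P (B `&` H) \is a fin_num by apply: fin_num_measure; exact: measurableI.
rewrite setIC -setDE measureD// ?ltey_eq ?fB// fineB//.
have PB' : 0 < fine (P B) by rewrite fine_gt0// PB ltey_eq fB.
rewrite mulrBl divff ?gt_eqF// lerD2l lerN2 ler_pdivrMr//.
rewrite mulrC; move: BH; rewrite -{1}(fineK fB) -{1}(fineK fBH) -EFinM lee_fin.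
done.
Qed.

(** The exponential loses at most [4 / 3 * ln rho] in the exponent, which the factor [rho ^+ 3]
    compensates. *)
Lemma expR_bound_trivial (R : realType) (rho e x : R) :
  1 < rho -> 1 <= x -> x * e <= 2 ->
  1 <= rho ^+ 3 * x ^+ 2 * expR (- (2 * x * (e * ln rho / 3))).
Proof.
move=> rho1 x1 xe.
have l0 : 0 < ln rho by exact: ln_gt0.
have -> : rho ^+ 3 = expR (3 * ln rho).
  by rewrite expRM_natl lnK// posrE; lra.
rewrite mulrAC -expRD -[leLHS]mulr1 ler_pM// ?exprn_ege1//.
rewrite -[leLHS]expR0 ler_expR; nra.
Qed.

(** The divisor 3 in [k] balances the rates: the initial value decays like [expR (- (3 * n * k))]
    and the time horizon costs [expR (k * n)], leaving the rate [2 * k]. *)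
Lemma expR_bound (R : realType) (rho e k : R) (a b n : nat) :
  1 < rho -> 0 < e -> (0 < n)%N -> a%:R - b%:R <= 2 - n%:R * e ->
  k = e * ln rho / 3 ->
  rho ^+ a / rho ^+ b + expR (k * n%:R) * (rho ^+ a / rho ^+ b * ((rho - 1) * n%:R)) <=
  rho ^+ 3 * n%:R ^+ 2 * expR (- (2 * n%:R * k)).
Proof.
move=> rho1 e0 n0 ab kE.
have l0 : 0 < ln rho by exact: ln_gt0.
have k0 : 0 < k by rewrite kE; nra.
have rE : rho = expR (ln rho) by rewrite lnK// posrE; lra.
have rX m : rho ^+ m = expR (m%:R * ln rho) by rewrite expRM_natl -rE.
have n1 : 1 <= n%:R :> R by rewrite ler1n.
have W : rho ^+ a / rho ^+ b <= rho ^+ 2 * expR (- (3 * n%:R * k)).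
  rewrite !rX -expRN -!expRD ler_expR kE.
  have := ler_wpM2r (ltW l0) ab; lra.
have t1 : 1 <= expR (k * n%:R) by rewrite -[leLHS]expR0 ler_expR mulr_ge0// ltW.
set t := expR (k * n%:R) in t1 *; set w := rho ^+ a / rho ^+ b in W *.
have w0 : 0 <= w by rewrite divr_ge0// exprn_ge0; lra.
apply: (@le_trans _ _ (w * (t * (rho * n%:R ^+ 2)))).
  have -> : w + t * (w * ((rho - 1) * n%:R)) = w * (1 + t * ((rho - 1) * n%:R)) by ring.
  apply: ler_wpM2l => //.
  apply: (@le_trans _ _ (t * (1 + (rho - 1) * n%:R))); first by rewrite mulrDr mulr1 lerD2r.
  apply: ler_wpM2l; first by lra.
  (* From [rho * n * (n - 1) >= 0] and [n >= 1] follows [1 + (rho - 1) * n <= rho * n ^+ 2]. *)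
  have := mulr_ge0 (mulr_ge0 (_ : 0 <= rho) (_ : 0 <= n%:R)) (_ : 0 <= n%:R - 1).
  rewrite ler0n subr_ge0 n1; move=> /(_ _ isT isT); lra.
have -> : rho ^+ 3 * n%:R ^+ 2 * expR (- (2 * n%:R * k)) =
  rho ^+ 2 * expR (- (3 * n%:R * k)) * (t * (rho * n%:R ^+ 2)).
  have -> : expR (- (2 * n%:R * k)) = expR (- (3 * n%:R * k)) * t.
    by rewrite /t -expRD; congr expR; ring.
  ring.
by rewrite ler_wpM2r// !mulr_ge0 ?exprn_ge0//; lra.
Qed.

Lemma ereal_gt1_witness (R : realType) (x : \bar R) : (1 < x)%E ->
  exists2 r : R, 1 < r & (r%:E <= x)%E.
Proof.
case: x => [r||] //; first by rewrite lte_fin => r1; exists r.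
by move=> _; exists 2; rewrite ?leey// ltr1n.
Qed.

(** A lower bound on an infimum only asks that no hit occur before [tau], so the infimum need not be
    attained. *)
Lemma hitting_time_ge (R : realType) (T : Type) (n : nat)
    (Y : R -> T -> 'I_n.+1) (r tau : R) :
  [set w | (tau%:E <= hitting_time Y r w)%E] =
  ~` hit_before Y (fun i => ((i : nat)%:Z == Num.ceil (n%:R * r)) ||
                            ((i : nat)%:Z == Num.floor (n%:R * r))) tau.
Proof.
apply/seteqP; split => w /=.
  move=> H [t /andP[t0 tt] tgt].
  have : (tau%:E <= t%:E)%E.
    apply: le_trans H _; apply: ereal_inf_lbound; exists t => //; split=> //.
    by case/orP: tgt => /eqP; [left|right].
  by rewrite lee_fin leNgt tt.
move=> H; apply: le_ereal_inf_tmp => _ [t [t0 tgt] <-].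
rewrite lee_fin leNgt; apply/negP => tt; apply: H; exists t; first by rewrite t0.
by case: tgt => ->; rewrite eqxx ?orbT.
Qed.

(** * Choice of the constants and conclusion *)

Theorem lemma4p3 (R : realType) (f g : nat -> R -> R) (r1 r2 : R)
  (d : nat -> measure_display) (Omega : forall n : nat, measurableType (d n))
  (P : forall n : nat, probability (Omega n) R)
  (Y : forall n : nat, R -> Omega n -> 'I_n.+1)
  (Ychain : forall n : nat, (0 < n)%N ->
    is_birth_death_chain (P n) (scaled_rate (f n)) (scaled_rate (g n))
      (Y n))
  (fcont : forall n : nat, (0 < n)%N -> {within `[0, 1], continuous (f n)})
  (gcont : forall n : nat, (0 < n)%N -> {within `[0, 1], continuous (g n)})
  (fge0 : forall (n : nat) (z : R), (0 < n)%N -> 0 <= z <= 1 -> 0 <= f n z)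
  (gge0 : forall (n : nat) (z : R), (0 < n)%N -> 0 <= z <= 1 -> 0 <= g n z)
  (fgt0 : forall (n : nat) (z : R), (0 < n)%N -> 0 < z < 1 -> 0 < f n z)
  (ggt0 : forall (n : nat) (z : R), (0 < n)%N -> 0 < z < 1 -> 0 < g n z)
  (r1_gt0 : 0 < r1) (r1_lt_r2 : r1 < r2) (r2_lt1 : r2 < 1)
  (drift : forall (n : nat) (z : R), (0 < n)%N -> r1 < z < r2 ->
    f n z - g n z < 0)
  (c : R) (n0 : nat) (c_gt1 : 1 < c) (n0_ge1 : (1 <= n0)%N)
  (rate_bound : forall (n : nat) (y : 'I_n.+1), (n0 <= n)%N ->
    0 < scaled_rate (g n) y + scaled_rate (f n) y <= c^-1 * n%:R)
  (h := fun (n : nat) (z : R) => g n z / f n z)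
  (h_inf : forall eps : R, 0 < eps ->
    (1 < ereal_inf [set (h n z)%:E | n in [set n : nat | (0 < n)%N]
                                   & z in [set z : R | r1 + eps <= z <= r2 - eps]%R])%E)
  (h_derivable : forall (n : nat) (z : R), (0 < n)%N -> r1 <= z <= r2 ->
    derivable (h n) z 1)
  (h_derive_bounded :
    (ereal_sup [set (`|derive1 (h n) z|%R)%:E | n in [set n : nat | (0 < n)%N]
                                        & z in [set z : R | r1 <= z <= r2]%R] < +oo)%E)
  (p : R) (p_in : r1 < p < r2) :
  exists kappa1 kappa2 : R,
    [/\ 0 < kappa1, 0 < kappa2 &
      forall n : nat, (maxn 2 n0 <= n)%N ->
        let start := [set w | (Y n 0 w : nat)%:Z = Num.ceil (n%:R * p)] in
        (0 < P n start)%E ->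
        1 - kappa2 * n%:R ^+ 2 * expR (- (2 * n%:R * kappa1))
          <= cond_prob (P n)
               [set w | ((expR (kappa1 * n%:R))%:E
                          <= hitting_time (Y n) r2 w)%E]
               start].
Proof.
have /andP[r1p pr2] := p_in.
(* This choice puts [p] in [[r1 + eps, r2 - eps]] and leaves a gap of at least [(r2 - p) / 2] to the
   right of [p]. *)
pose eps := Num.min (p - r1) ((r2 - p) / 2).
have eps0 : 0 < eps by rewrite lt_min subr_gt0 r1p divr_gt0// subr_gt0.
have epsl : eps <= p - r1 by rewrite ge_min lexx.
have epsr : eps <= (r2 - p) / 2 by rewrite ge_min lexx orbT.
have [rho rho1 rhole] := ereal_gt1_witness _ _ (h_inf eps eps0).
have hrho n z : (0 < n)%N -> r1 + eps <= z <= r2 - eps -> rho <= h n z.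
  move=> n_gt0 zI; rewrite -lee_fin; apply: le_trans rhole _.
  by apply: ereal_inf_lbound; exists n => //; exists z.
pose e := r2 - eps - p.
have e0 : 0 < e by rewrite /e; lra.
have rho0 : 0 < rho by exact: lt_trans rho1.
have l0 : 0 < ln rho by exact: ln_gt0.
exists (e * ln rho / 3), (rho ^+ 3); split.
- by rewrite divr_gt0// mulr_gt0.
- exact: exprn_gt0.
move=> n; rewrite geq_max => /andP[n2 nn0] start Pstart.
have n_gt0 : (0 < n)%N by exact: ltnW.
have nR : 0 < n%:R :> R by rewrite ltr0n.
(* A sample point of the nonnull starting event exhibits [ceil (n * p)] as an actual state of the
   chain. *)
have [w0 startw0] : start !=set0.
  by apply/set0P/eqP => st0; move: Pstart; rewrite st0 measure0 ltxx.
pose a := Y n 0 w0.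
have aE : (a : nat)%:Z = Num.ceil (n%:R * p) := startw0.
have stE : start = [set w | Y n 0 w = a].
  apply/seteqP; split => w /=; last by rewrite /start /= => ->.
  by rewrite /start /= -aE => -[] /val_inj.
have /andP[alo ahi] := ceil_itv (n%:R * p).
rewrite -aE in alo ahi.
have {}ahi : n%:R * p <= a%:R by [].
have {}alo : a%:R < n%:R * p + 1 by rewrite -ltrBlDr; move: alo; rewrite intrB.
have nr0 : 0 <= n%:R * (r2 - eps) by rewrite mulr_ge0// ?ler0n//; lra.
have /andP[blo bhi] := truncn_itv nr0.
set b := Num.truncn _ in blo bhi.
have ch := Ychain n n_gt0.
have [[qm0 qpn] Ym _ _] := ch.
have mst : measurable start by rewrite stE; exact: Ym.
have unit_i (i : 'I_n.+1) : 0 <= (i%:R / n%:R : R) <= 1.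
  by rewrite divr_ge0//= ler_pdivrMr// mul1r ler_nat -ltnS.
have qp0 (i : 'I_n.+1) : 0 <= scaled_rate (f n) i by rewrite mulr_ge0// fge0.
have qm_ge0 (i : 'I_n.+1) : 0 <= scaled_rate (g n) i by rewrite mulr_ge0// gge0.
rewrite hitting_time_ge; set tgt := (X in hit_before _ X _).
set tau := expR (e * ln rho / 3 * n%:R).
have tau0 : 0 < tau by exact: expR_gt0.
have [ba|ab] := leqP b a.
  (* For [b <= a] one has [n e < 2] and the claimed lower bound is nonpositive. *)
  apply: (@le_trans _ _ 0); last by rewrite divr_ge0// fine_ge0.
  rewrite subr_le0; apply: expR_bound_trivial => //; first by rewrite ler1n.
  have : (b%:R <= a%:R :> R) by rewrite ler_nat.
  by move: bhi; rewrite -natr1 /e; lra.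
pose V := clip_pow rho a b.
pose E := rho ^+ a / rho ^+ b * ((rho - 1) * n%:R).
have rb k : 0 < rho ^+ k / rho ^+ b by rewrite divr_gt0// exprn_gt0.
have E_ge0 : 0 <= E by rewrite mulr_ge0 ?(ltW (rb _))// mulr_ge0// subr_ge0 ltW.
have V0 (i : 'I_n.+1) : 0 <= V i by exact: ltW (rb _).
(* Both roundings of [n * r2] are at least [b], where the potential equals 1. *)
have Vtgt (i : 'I_n.+1) : tgt i -> 1 <= V i.
  move=> ti; have bi : (b <= i)%N.
    have bf : b%:Z <= Num.floor (n%:R * r2).
      by rewrite floor_ge_int; apply: le_trans blo _; rewrite ler_wpM2l//; lra.
    have fc : Num.floor (n%:R * r2) <= Num.ceil (n%:R * r2).
      by rewrite -(ler_int R) (le_trans (floor_le _))// ceil_ge.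
    by case/orP: ti => /eqP iE; rewrite -lez_nat iE // (le_trans bf).
  by rewrite /V clip_pow_right.
have QV (i : 'I_n.+1) : \sum_j bd_generator (scaled_rate (f n)) (scaled_rate (g n)) i j * V j < E.
  apply: clip_pow_drift => // {}i.
    (* Here [c > 1] makes the total rate, hence the birth rate, strictly smaller than [n]. *)
    move=> _; have /andP[_] := rate_bound n i nn0.
    have : c^-1 * n%:R < n%:R by rewrite gtr_pMl// invf_lt1//; lra.
    by have := qm_ge0 i; lra.
  case/andP => ai ib.
  have aiR : (a%:R < i%:R :> R) by rewrite ltr_nat.
  have ibR : (i%:R < b%:R :> R) by rewrite ltr_nat.
  set z : R := i%:R / n%:R.
  have zlo : p <= z by rewrite ler_pdivlMr// mulrC; lra.
  have zhi : z <= r2 - eps by rewrite ler_pdivrMr// mulrC; lra.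
  have fz : 0 < f n z by apply: fgt0 => //; lra.
  have : rho <= h n z by apply: hrho => //; lra.
  rewrite /h ler_pdivlMr// /scaled_rate -/z mulrCA => H.
  by rewrite ler_wpM2l.
have [mH PH] := chain_hit_before _ _ _ _ _ _ _ _ tgt V E tau a ch tau0 E_ge0 V0 Vtgt QV.
apply: (@le_trans _ _ (1 - (V a + tau * E))).
  rewrite lerD2l lerN2.
  rewrite /V clip_pow_left ?(ltnW ab)//.
  (* Rounding up [n * p] and rounding down [n * (r2 - eps)] each cost at most 1, whence the constant
     2. *)
  have abe : a%:R - b%:R <= 2 - n%:R * e.
    by move: bhi; rewrite -natr1 /e; lra.
  exact: (expR_bound _ _ _ _ _ _ _ rho1 e0 n_gt0 abe erefl).
by apply: cond_prob_setC_ge => //; rewrite stE.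
Qed.
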